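(* Let $\mathcal{C}$ be an extension-closed variety of finite groups which is not contained in the variety of finite solvable groups, and let $\pi(\mathcal{C})$ be the set of primes involved in $\mathcal{C}$. Assume further that for every $p\in\pi(\mathcal{C})$ the cyclic group $C_p$ of order $p$ belongs to $\mathcal{C}$. Let $F$ be a free pro-$\mathcal{C}$ group of rank greater than one. Then $F$ can be cancelled from direct products of profinite groups: for all profinite groups $A,B$, if $F\times A\cong F\times B$ then $A\cong B$.
   Context: All homomorphisms and isomorphisms between profinite groups are continuous. A variety of finite groups is a nonempty class of finite groups closed under isomorphism, subgroups, quotients and finite direct products; it is extension-closed if whenever $1\to N\to E\to Q\to 1$ is exact with $N,Q\in\mathcal{C}$, then $E\in\mathcal{C}$. The primes involved in $\mathcal{C}$ are the primes dividing the order of some group in $\mathcal{C}$. A pro-$\mathcal{C}$ group is an inverse limit of groups in $\mathcal{C}$. The free pro-$\mathcal{C}$ group of rank $\kappa$ (a possibly infinite cardinal) is the free pro-$\mathcal{C}$ group on a set of cardinality $\kappa$ converging to $1$. *)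

(* Defs.v *)
From HB Require Import structures.
From mathcomp Require Import all_boot all_order all_algebra.
From mathcomp Require Import all_fingroup all_solvable.
From mathcomp Require Import all_classical topology function_spaces.

Set Implicit Arguments.
Unset Strict Implicit.
Unset Printing Implicit Defensive.

Local Open Scope classical_set_scope.
Local Open Scope group_scope.

HB.mixin Record isTopologicalGroup G of Topological G & monoid.Group G := {
  mulg_continuous : continuous (fun x : G * G => x.1 * x.2);
  invg_continuous : continuous (fun x : G => x^-1)
}.

#[short(type="topologicalGroupType")]
HB.structure Definition TopologicalGroup :=
  {G of Topological G & monoid.Group G & isTopologicalGroup G}.

Section ProductTopologicalGroup.
Variables G H : topologicalGroupType.

Let fst_continuous (S T : topologicalType) : continuous (@fst S T).
Proof. by move=> x; exact: cvg_fst. Qed.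

Let snd_continuous (S T : topologicalType) : continuous (@snd S T).
Proof. by move=> x; exact: cvg_snd. Qed.

Let pair_continuous (S T U : topologicalType) (f : S -> T) (g : S -> U) :
  continuous f -> continuous g -> continuous (fun x => (f x, g x)).
Proof. by move=> cf cg x; apply: cvg_pair; [exact: cf | exact: cg]. Qed.

Let comp_continuous (S T U : topologicalType) (f : S -> T) (g : T -> U) :
  continuous f -> continuous g -> continuous (g \o f).
Proof. by move=> cf cg x; apply: continuous_comp; [exact: cf | exact: cg]. Qed.

Let mul_pair_continuous :
  continuous (fun x : (G * H) * (G * H) => x.1 * x.2).
Proof.
have cproj (K : topologicalType) (p : G * H -> K) : continuous p ->
    continuous (fun x : (G * H) * (G * H) => (p x.1, p x.2)).
  move=> cp; apply: pair_continuous.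
  - exact: comp_continuous (@fst_continuous _ _) cp.
  - exact: comp_continuous (@snd_continuous _ _) cp.
apply: pair_continuous.
- exact: comp_continuous (cproj _ _ (@fst_continuous G H)) mulg_continuous.
- exact: comp_continuous (cproj _ _ (@snd_continuous G H)) mulg_continuous.
Qed.

Let inv_pair_continuous : continuous (fun x : G * H => x^-1).
Proof.
apply: pair_continuous.
- exact: comp_continuous (@fst_continuous G H) invg_continuous.
- exact: comp_continuous (@snd_continuous G H) invg_continuous.
Qed.

HB.instance Definition _ :=
  isTopologicalGroup.Build (G * H)%type mul_pair_continuous inv_pair_continuous.

End ProductTopologicalGroup.

Definition continuous_hom (G H : topologicalGroupType) (f : G -> H) : Prop :=
  {morph f : x y / x * y} /\ continuous f.

Definition topologically_isomorphic (G H : topologicalGroupType) : Prop :=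
  exists (f : G -> H) (g : H -> G),
    [/\ continuous_hom f, continuous_hom g, cancel f g & cancel g f].

(* Finite groups are represented by subgroups of an ambient finGroupType. *)
Definition finite_group_class := forall gT : finGroupType, {group gT} -> Prop.

Definition all_finite_groups : finite_group_class := fun _ _ => True.

Record is_variety (C : finite_group_class) : Prop := IsVariety {
  variety_nonempty : exists (gT : finGroupType) (G : {group gT}), C gT G;
  variety_isog : forall (gT hT : finGroupType) (G : {group gT}) (H : {group hT}),
    G \isog H -> C gT G -> C hT H;
  variety_subgroup : forall (gT : finGroupType) (G H : {group gT}),
    H \subset G -> C gT G -> C gT H;
  variety_quotient : forall (gT : finGroupType) (G N : {group gT}),
    N <| G -> C gT G -> C (coset_of N) (G / N)%G;
  variety_product :
    forall (I : finType) (gT : I -> finGroupType) (G : forall i, {group gT i}),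
    (forall i, C (gT i) (G i)) -> C {dffun forall i, gT i} (setXn_group G)
}.

(* The hypotheses on i and q say that 1 -> N -> E -> Q -> 1 is exact. *)
Definition extension_closed (C : finite_group_class) : Prop :=
  forall (nT eT qT : finGroupType)
         (N : {group nT}) (E : {group eT}) (Q : {group qT})
         (i : {morphism N >-> eT}) (q : {morphism E >-> qT}),
    'injm i -> i @* N = 'ker q -> q @* E = Q ->
    C nT N -> C qT Q -> C eT E.

Definition involved_primes (C : finite_group_class) : set nat :=
  [set p | prime p /\
    exists (gT : finGroupType) (G : {group gT}), C gT G /\ p %| #|G|].

Record inverse_system := InverseSystem {
  sys_index : Type;
  sys_le : sys_index -> sys_index -> Prop;
  sys_le_refl : forall i, sys_le i i;
  sys_le_anti : forall i j, sys_le i j -> sys_le j i -> i = j;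
  sys_le_trans : forall i j k, sys_le i j -> sys_le j k -> sys_le i k;
  sys_inhabited : inhabited sys_index;
  sys_directed : forall i j, exists k, sys_le i k /\ sys_le j k;
  component : sys_index -> finGroupType;
  transition : forall i j, sys_le i j -> component j -> component i;
  transitionM : forall i j (ij : sys_le i j),
    {morph transition ij : x y / x * y};
  transition_id : forall i (ii : sys_le i i) x, transition ii x = x;
  transition_comp : forall i j k
    (ij : sys_le i j) (jk : sys_le j k) (ik : sys_le i k) x,
    transition ij (transition jk x) = transition ik x
}.

Definition component_product (S : inverse_system) : topologicalType :=
  prod_topology (fun i : sys_index S => discrete_topology (component i)).

Definition threads (S : inverse_system) : set (component_product S) :=
  [set x | forall i j (ij : sys_le i j), transition ij (x j) = x i].

(* The threads, with the subspace topology and the componentwise product, form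
   the inverse limit; f identifies G with it as a topological group. *)
Definition is_inverse_limit (S : inverse_system) (G : topologicalGroupType) :
    Prop :=
  exists f : G -> component_product S,
    [/\ forall x y i, f (x * y) i = f x i * f y i :> component i,
        injective f,
        range f = @threads S
      & forall U : set G,
          open U <->
          exists2 V : set (component_product S), open V & f @^-1` V = U].

Definition pro (C : finite_group_class) (G : topologicalGroupType) : Prop :=
  exists S : inverse_system,
    (forall i : sys_index S, C (component i) [set: component i]%G) /\
    is_inverse_limit S G.

Definition profinite : topologicalGroupType -> Prop := pro all_finite_groups.

(* The preimages, not the images, are required to be cofinite: phi may take
   each nontrivial value only finitely often. *)
Definition converges_to_1 (X : Type) (G : topologicalGroupType) (phi : X -> G) :
    Prop :=
  forall U : set G, nbhs 1 U -> cofinite_set (phi @^-1` U).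

Definition is_free_pro (C : finite_group_class) (X : Type)
    (F : topologicalGroupType) (iota : X -> F) : Prop :=
  [/\ pro C F,
      converges_to_1 iota
    & forall (G : topologicalGroupType) (phi : X -> G),
        pro C G -> converges_to_1 phi ->
        exists! f : F -> G,
          continuous_hom f /\ forall x, f (iota x) = phi x].

(* Main.v *)
(** Composing an isomorphism F x A -> F x B with the projection to F exhibits F
as a product of two commuting subgroups M and N, the images of F and of A; once
M = 1 or N = 1, for the isomorphism and for its inverse, an isomorphism A -> B
is written down explicitly.

To see that M = 1 or N = 1, let f : F -> G be a homomorphism onto a finite group
in C and x a basis element.  Lift f to the wreath product of G by a cyclic group
<a> of large order, sending x to (delta_1(a), f x) and every other basis element
y to (1, f y).  If n = #|G|, the base component of x^n counts the j < n with
(f x)^j = g, and, writing x = u v with u in M and v in N, it is the product of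
the components of u^n, invariant under f N, and of v^n, invariant under f M.
Comparing its values at 1, f m, f n and f m * f n shows that f m or f n lies in
<f x>.  Hence f M or f N is contained in <f x>, for each x.  If M and N are both
nontrivial, this is contradicted by an f with nonabelian image, nontrivial on M
and on N, such that <f x> and <f y> meet trivially for two basis elements x and
y. *)

Require Import Defs.
From HB Require Import structures.
From mathcomp Require Import all_boot all_order all_algebra.
From mathcomp Require Import all_fingroup all_solvable.
From mathcomp Require Import all_classical topology function_spaces.

Set Implicit Arguments.
Unset Strict Implicit.
Unset Printing Implicit Defensive.

Local Open Scope classical_set_scope.
Local Open Scope card_scope.
Local Open Scope group_scope.

(** * Wreath products and commuting factorisations *)

(* The pair (s, g) stands for the product of s : gT -> aT and g; gT acts on
   functions by left translation. *)
Definition wreath (aT gT : finGroupType) : Type := ({ffun gT -> aT} * gT)%type.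

Section WreathGroup.
Variables aT gT : finGroupType.
Local Notation W := (wreath aT gT).
Implicit Types u v : W.

HB.instance Definition _ := Finite.on W.

Definition wreath_one : W := ([ffun=> 1], 1).
Definition wreath_mul u v : W :=
  ([ffun x => u.1 x * v.1 (u.2^-1 * x)], u.2 * v.2).
Definition wreath_inv u : W := ([ffun x => (u.1 (u.2 * x))^-1], u.2^-1).

Lemma wreath_mulA : associative wreath_mul.
Proof.
move=> u v w; congr (_, _); last exact: mulgA.
by apply/ffunP => x; rewrite !ffunE /= invMg !mulgA.
Qed.

Lemma wreath_mul1 : left_id wreath_one wreath_mul.
Proof.
case=> s g; congr (_, _); last exact: mul1g.
by apply/ffunP => x; rewrite !ffunE /= invg1 !mul1g.
Qed.

Lemma wreath_mulV : left_inverse wreath_one wreath_inv wreath_mul.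
Proof.
move=> u; congr (_, _); last exact: mulVg.
by apply/ffunP => x; rewrite !ffunE /= invgK mulVg.
Qed.

HB.instance Definition _ :=
  Finite_isGroup.Build W wreath_mulA wreath_mul1 wreath_mulV.

Lemma wreath_mulE u v x : (u * v).1 x = u.1 x * v.1 (u.2^-1 * x).
Proof. by rewrite ffunE. Qed.

Lemma wreath_expg_snd u k : (u ^+ k).2 = u.2 ^+ k.
Proof. by elim: k => // k IHk; rewrite !expgS -IHk. Qed.

Definition wreath_delta (a : aT) (g : gT) : W :=
  ([ffun x => if x == 1 then a else 1], g).

(** The factor of index [j] in the power is translated by [g ^+ j], so its value [a] sits at
    [g ^+ j]. *)
Lemma wreath_delta_expgE a g k x :
  (wreath_delta a g ^+ k).1 x = a ^+ count (fun j => g ^+ j == x) (iota 0 k).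
Proof.
elim: k => [|k IHk]; first by rewrite ffunE.
rewrite expgSr wreath_mulE IHk wreath_expg_snd ffunE -addn1 iotaD add0n.
rewrite count_cat expgnDr /= addn0 (eq_mulVg1 (g ^+ k)).
by case: eqP.
Qed.

(** Let [a ^+ c x] be the value at [x] of the base part of the [#|gT|]-th power. As [d] is invariant
    under [n.2] and [e] under [m.2], the exponents [c 1 + c (m.2 * n.2)] and [c m.2 + c n.2] give
    the same power of [a]. If neither [m.2] nor [n.2] lies in [<[g]>], the second exponent is 0,
    while the first is positive and at most [#|gT|.*2], hence below the order of [a]. *)
Lemma wreath_commuting (a : aT) (g : gT) (u v m n : W) :
  (forall b c : aT, commute b c) -> (#|gT|.*2 < #[a])%N ->
  commute u v -> commute u n -> commute m v -> commute m n ->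
  u * v = wreath_delta a g ->
  (m.2 \in <[g]>) || (n.2 \in <[g]>).
Proof.
move=> abA lt_a cuv cun cmv cmn uvE.
have expn1 (w : gT) : w ^+ #|gT| = 1.
  by apply/eqP; rewrite -order_dvdn -cardsT order_dvdG ?inE.
pose N := #|gT|; pose d := (u ^+ N).1; pose e := (v ^+ N).1.
have u2 : (u ^+ N).2 = 1 by rewrite wreath_expg_snd expn1.
have v2 : (v ^+ N).2 = 1 by rewrite wreath_expg_snd expn1.
(* A base element commuting with [w] is invariant under translation by [w.2], because the base part
   of [w] acts trivially on the abelian base group. *)
have inv (w y : W) : commute w y -> y.2 = 1 -> forall x, y.1 (w.2 * x) = y.1 x.
  move=> cwy y2 x; move: (congr1 (fun z : W => z.1 (w.2 * x)) cwy).
  rewrite !wreath_mulE y2 invg1 mul1g mulKg [RHS]abA.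
  by move/mulgI.
have dn x : d (n.2 * x) = d x.
  by apply: inv => //; apply: commuteX; apply: commute_sym.
have em x : e (m.2 * x) = e x by apply: inv => //; apply: commuteX.
have cmn2 : m.2 * n.2 = n.2 * m.2 by exact: (congr1 (fun z : W => z.2) cmn).
pose c (x : gT) := count (fun j => g ^+ j == x) (iota 0 N).
have cE x : a ^+ c x = d x * e x.
  by rewrite -wreath_delta_expgE -uvE expgMn // wreath_mulE u2 invg1 mul1g.
have c_le x : (c x <= N)%N by rewrite -[leqRHS](size_iota 0) count_size.
have c0 x : x \notin <[g]> -> c x = 0%N.
  move=> xg; apply/eqP; rewrite -leqn0 leqNgt -has_count; apply/negP.
  by case/hasP => j _ /eqP gx; rewrite -gx mem_cycle in xg.
(* The index [j = 0] is counted at 1. *)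
have c1 : (0 < c 1%g)%N.
  rewrite -has_count; apply/hasP; exists 0%N; rewrite ?expg0 //.
  by rewrite mem_iota /= add0n; apply/card_gt0P; exists g.
apply/negPn/negP; rewrite negb_or => /andP[/c0 cm0 /c0 cn0].
have : a ^+ (c 1%g + c (m.2 * n.2)%g) = 1.
  transitivity (a ^+ c m.2 * a ^+ c n.2); last by rewrite cm0 cn0 mulg1.
  have em1 : e m.2 = e 1 by rewrite -[m.2]mulg1 em.
  have dn1 : d n.2 = d 1 by rewrite -[n.2]mulg1 dn.
  rewrite expgnDr !cE em cmn2 dn em1 dn1 [d 1 * e 1]abA [d m.2 * e 1]abA.
  by rewrite -!mulgA; congr (_ * _); rewrite !mulgA [d 1 * _]abA.
move/eqP; rewrite -order_dvdn => /dvdn_leq; rewrite addn_gt0 c1 => /(_ isT).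
by rewrite leqNgt (leq_ltn_trans _ lt_a) // -addnn leq_add.
Qed.

End WreathGroup.

(** * Closure properties of extension-closed varieties *)

Section Varieties.
Variable C : finite_group_class.
Hypotheses (C_variety : is_variety C) (C_ext : extension_closed C).

(** Extension closure for plain functions on whole types, the form applied to products and wreath
    products. *)
Lemma extension_closedT (nT eT qT : finGroupType)
  (i : nT -> eT) (q : eT -> qT) :
  {morph i : x y / x * y} -> {morph q : x y / x * y} -> injective i ->
  (forall z, q (i z) = 1) -> (forall e, q e = 1 -> exists z, e = i z) ->
  (forall y, exists e, q e = y) ->
  C [set: nT]%G -> C [set: qT]%G -> C [set: eT]%G.
Proof.
move=> iM qM i_inj qi ker_q q_surj.
have iM' : {in [set: nT]%G &, {morph i : x y / x * y}} by move=> x y _ _.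
have qM' : {in [set: eT]%G &, {morph q : x y / x * y}} by move=> x y _ _.
apply: (@C_ext _ _ _ _ _ _ (Morphism iM') (Morphism qM')).
- by apply/injmP => x y _ _; apply: i_inj.
- apply/setP => e; apply/imsetP/idP => [[z _ ->]|].
    by rewrite !inE /= qi.
  rewrite !inE /= => /eqP/ker_q[z ->].
  by exists z => //; rewrite !inE.
- apply/setP => y; rewrite inE; have [e <-] := q_surj y.
  by apply/imsetP; exists e; rewrite ?inE.
Qed.

Lemma variety_prod (gT hT : finGroupType) :
  C [set: gT]%G -> C [set: hT]%G -> C [set: gT * hT]%G.
Proof.
move=> Cg Ch; apply: (@extension_closedT gT _ hT (fun x => (x, 1)) snd) => //.
- by move=> x y; congr (_, _); rewrite mulg1.
- by move=> x y [].
- by case=> x y /= ->; exists x.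
- by move=> y; exists (1, y).
Qed.

(** The base group is a finite direct power of [aT], and the quotient by it is [gT]. *)
Lemma variety_wreath (aT gT : finGroupType) :
  C [set: aT]%G -> C [set: gT]%G -> C [set: wreath aT gT]%G.
Proof.
move=> Ca Cg.
have := @variety_product _ C_variety gT (fun=> aT) (fun=> [set: aT]%G)
  (fun=> Ca).
have -> : setXn_group (fun _ : gT => [set: aT]%G) = [set: _]%G.
  by apply/val_inj/setP => x; rewrite !inE; apply/forallP => y; rewrite inE.
move=> Cn; apply: (@extension_closedT _ _ gT
  (fun s : {dffun gT -> aT} => (s : {ffun gT -> aT}, 1) : wreath aT gT) snd)
  => //.
- move=> s t; congr (_, _); last by rewrite mulg1.
  by apply/ffunP => x; rewrite !ffunE /= invg1 mul1g.
- by move=> x y [].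
- by case=> x y /= ->; exists x.
- by move=> y; exists ([ffun=> 1], y).
Qed.

Lemma variety_subg (gT : finGroupType) (G : {group gT}) :
  C G -> C [set: subg_of G]%G.
Proof. by move=> CG; apply: variety_isog CG => //; exact: isog_subg. Qed.

Lemma variety_extension (gT : finGroupType) (G N : {group gT}) :
  N <| G -> C N -> C (G / N)%G -> C G.
Proof.
move=> nNG CN CGN.
apply: (@C_ext _ _ _ N G (G / N)%G (idm_morphism N)
          (restrm_morphism (normal_norm nNG) (coset_morphism N))) => //.
- exact: injm_idm.
- rewrite morphim_idm // ker_restrm ker_coset.
  by apply/esym/finset.setIidPr/normal_sub.
- by rewrite morphim_restrm finset.setIid.
Qed.

(** Induction on the order: divide by a subgroup of order [p], which is normal because [G] is
    abelian. *)
Lemma variety_abelian_pgroup p (gT : finGroupType) (G : {group gT}) :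
  prime p -> C (Zp_group p) -> abelian G -> p.-group G -> C G.
Proof.
move=> p_pr Cp; have [k] := ubnP #|G|.
elim: k gT G => // k IHk gT G ltk abG pG.
have [G1|ntG] := eqVneq (G : {set gT}) 1.
  have [hT [H CH]] := variety_nonempty C_variety.
  apply: (variety_isog C_variety (G := 1%G :> {group hT})).
    by rewrite trivial_isog.
  by apply: variety_subgroup CH => //; rewrite sub1G.
have [_ p_dvd _] := pgroup_pdiv pG ntG.
have [x Gx ox] := Cauchy p_pr p_dvd.
have nxG : <[x]> <| G by rewrite -sub_abelian_normal // cycle_subG.
apply: (variety_extension nxG).
- apply: variety_isog Cp => //.
  have cardZ : #|Zp_group p| = p by rewrite card_Zp ?prime_gt0.
  rewrite isog_cyclic_card ?cycle_cyclic ?prime_cyclic ?cardZ //=.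
  by rewrite -orderE ox.
- apply: IHk; rewrite ?quotient_abelian ?quotient_pgroup //.
  rewrite -ltnS; apply: leq_trans ltk; rewrite ltnS ltn_quotient ?cycle_subG //.
  by rewrite cycle_eq1 -order_gt1 ox prime_gt1.
Qed.

Lemma variety_large_order p k : prime p -> C (Zp_group p) ->
  exists (aT : finGroupType) (a : aT),
    [/\ C [set: aT]%G, forall b c : aT, commute b c & (k < #[a])%N].
Proof.
move=> p_pr Cp; have lt_k := ltn_expl k (prime_gt1 p_pr).
(* The exponent [k.+1] keeps the modulus above 1 even for [k = 0]; ['Z_n] has [n] elements only when
   [n] exceeds 1. *)
have q_gt1 : (1 < p ^ k.+1)%N.
  by rewrite -[1%N](exp1n k.+1) ltn_exp2r // prime_gt1.
exists 'Z_(p ^ k.+1), Zp1; split.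
- apply: (variety_abelian_pgroup p_pr Cp).
    by apply/centsP => b _ c _; apply: Zp_mulgC.
  by rewrite /pgroup cardsT card_ord Zp_cast // pnatX pnat_id.
- exact: Zp_mulgC.
- rewrite order_Zp1 Zp_cast // ; apply: leq_trans lt_k _.
  by rewrite leq_exp2l ?prime_gt1.
Qed.

End Varieties.

(** * Finite groups as discrete topological groups *)

Section DiscreteGroup.

Definition discrete_group (gT : finGroupType) : Type := discrete_topology gT.

Variable gT : finGroupType.

HB.instance Definition _ := DiscreteTopology.on (discrete_group gT).
HB.instance Definition _ := monoid.Group.copy (discrete_group gT) gT.

Lemma continuous_discreteP (T : topologicalType) (f : T -> discrete_group gT) :
  continuous f <-> forall x : T, nbhs x [set y | f y = f x].
Proof.
by split=> cf x; have := cf x;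
  [move/discrete_cvg | move=> ?; apply/discrete_cvg].
Qed.

Let mul_continuous : continuous
  (fun x : discrete_group gT * discrete_group gT => x.1 * x.2).
Proof.
apply/continuous_discreteP => -[x y].
exists ([set x], [set y]) => /=; first by split; apply: discrete_set1.
by move=> [? ?] [/= -> ->].
Qed.

Let inv_continuous : continuous (fun x : discrete_group gT => x^-1).
Proof.
apply/continuous_discreteP => x.
apply: open_nbhs_nbhs; split=> //.
exact: (@discrete_open (discrete_group gT)).
Qed.

HB.instance Definition _ := isTopologicalGroup.Build (discrete_group gT)
  mul_continuous inv_continuous.

End DiscreteGroup.

(** * Pro-[C] groups and their maps to finite groups *)

Lemma open_component (S : inverse_system) (i : sys_index S)
  (U : set (component i)) : open [set y : component_product S | U (y i)].
Proof.
pose K j : topologicalType := discrete_topology (@component S j).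
have cp : continuous (fun y : component_product S => y i : K i).
  exact: (@proj_continuous {classic sys_index S} K i).
apply: ((continuousP _).1 cp U).
exact: (@discrete_open (discrete_topology (component i))).
Qed.

Section ProC.
Variable C : finite_group_class.

(** The inverse system has a single index, with the identity as transition map. *)
Lemma pro_discrete (gT : finGroupType) :
  C [set: gT]%G -> pro C (discrete_group gT).
Proof.
move=> CG.
unshelve eexists (@InverseSystem unit (fun _ _ => True) _ _ _ _ _ (fun=> gT)
  (fun _ _ _ x => x) _ _ _) => //.
- by move=> [] [].
split=> //; exists (fun x _ => x); split=> //.
- by move=> x y /(congr1 (fun f => f tt)).
- apply/seteqP; split=> [_ [x _ <-] //|y y_thread].
  by exists (y tt) => //; apply: functional_extensionality_dep => -[].
- move=> U; split=> [_|_]; last exact: discrete_open.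
  by exists [set y | U (y tt)] => //; exact: open_component.
Qed.

(** An inverse limit embeds in the product of its components, so some coordinate of [x] is
    nontrivial; the coordinate maps are continuous because cylinders are open. *)
Lemma pro_separated (G : topologicalGroupType) (x : G) : pro C G -> x <> 1 ->
  exists (gT : finGroupType) (f : G -> discrete_group gT),
    [/\ C [set: gT]%G, continuous_hom f & f x <> 1].
Proof.
case=> S [CS [f [fM f_inj _ f_open]]] x1.
have f1 i : f 1 i = 1 :> component i.
  by apply: (mulgI (f 1 i : component i)); rewrite -fM !mulg1.
have [i fxi] : exists i, f x i <> 1 :> component i.
  apply: contrapT => /forallNP fx1; apply: x1; apply: f_inj.
  apply: functional_extensionality_dep => i; rewrite f1.
  exact: contrapT (fx1 i).
exists (component i), (fun y => f y i); split=> //; split.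
  by move=> y z; exact: fM.
apply/continuousP => U _; apply/f_open.
by exists [set y | U (y i)] => //; exact: open_component.
Qed.

End ProC.

Lemma hom1 (G H : topologicalGroupType) (f : G -> H) :
  continuous_hom f -> f 1 = 1.
Proof. by move=> [fM _]; apply: (mulgI (f 1)); rewrite -fM !mulg1. Qed.

(** * Homomorphisms from a free pro-[C] group to finite groups *)

Section FreeProC.
Variable C : finite_group_class.
Hypotheses (C_variety : is_variety C) (C_ext : extension_closed C).
Variables (X : Type) (F : topologicalGroupType) (iota : X -> F).
Hypothesis F_free : is_free_pro C iota.

Lemma converges_to_1_discrete (gT : finGroupType)
  (phi : X -> discrete_group gT) :
  converges_to_1 phi <-> cofinite_set [set x | phi x = 1].
Proof.
split=> [phi1|fin U U1].
  by apply: (phi1 [set 1]); exact: (@discrete_set1 (discrete_group gT)).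
apply: sub_cofinite_set fin => x /= ->; exact: nbhs_singleton U1.
Qed.

Lemma free_pro_lift (gT : finGroupType) (phi : X -> gT) :
  C [set: gT]%G -> cofinite_set [set x | phi x = 1] ->
  exists2 f : F -> discrete_group gT,
    continuous_hom f & forall x, f (iota x) = phi x.
Proof.
move=> CG fin; case: F_free => _ _ univ.
have [|f [[f_hom f_iota] _]] :=
  univ (discrete_group gT) phi (pro_discrete CG).
  exact/converges_to_1_discrete.
by exists f.
Qed.

Lemma free_pro_eq (gT : finGroupType) (f g : F -> discrete_group gT) :
  C [set: gT]%G -> continuous_hom f -> continuous_hom g ->
  (forall x, f (iota x) = g (iota x)) -> f = g.
Proof.
move=> CG f_hom g_hom fg; case: F_free => _ iota1 univ.
have [|h [_ h_uniq]] := univ (discrete_group gT) (f \o iota) (pro_discrete CG).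
  move=> U U1; apply: (iota1 (f @^-1` U)).
  by apply: (f_hom.2 1); rewrite (hom1 f_hom).
by rewrite -(h_uniq f) //; apply: h_uniq; split=> // x; rewrite -fg.
Qed.

Lemma hom_iota_cofinite (gT : finGroupType) (f : F -> discrete_group gT) :
  continuous_hom f -> cofinite_set [set x | f (iota x) = 1].
Proof.
move=> f_hom; case: F_free => _ iota1 _.
apply: (iota1 [set y | f y = 1]).
by have := (continuous_discreteP _).1 f_hom.2 1; rewrite (hom1 f_hom).
Qed.

Lemma continuous_hom_discrete_pair (gT hT : finGroupType)
  (f : F -> discrete_group gT) (g : F -> discrete_group hT) :
  continuous_hom f -> continuous_hom g ->
  continuous_hom (fun y => (f y, g y) : discrete_group (gT * hT)%type).
Proof.
move=> [fM /continuous_discreteP cf] [gM /continuous_discreteP cg]; split.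
  by move=> x y; rewrite fM gM.
apply/continuous_discreteP => x.
by apply: filterS2 (cf x) (cg x) => y /= -> ->.
Qed.

Lemma continuous_hom_discrete_comp (gT hT : finGroupType)
  (f : F -> discrete_group gT) (q : gT -> hT) :
  {morph q : x y / x * y} -> continuous_hom f ->
  continuous_hom (fun y => q (f y) : discrete_group hT).
Proof.
move=> qM [fM /continuous_discreteP cf]; split.
  by move=> x y; rewrite fM qM.
by apply/continuous_discreteP => x; apply: filterS (cf x) => y /= ->.
Qed.

(** * Commuting subsets whose product is the free group *)

Hypothesis C_large_order : forall k, exists (aT : finGroupType) (a : aT),
  [/\ C [set: aT]%G, forall b c : aT, commute b c & (k < #[a])%N].

Variables M N : set F.
Hypothesis MN_commute : forall m n, M m -> N n -> m * n = n * m.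
Hypothesis MN_full : forall z, exists m n, [/\ M m, N n & z = m * n].

(** The map [f] is lifted to a homomorphism [t] into a wreath product, with [t (iota x)] a delta;
    the images under [t] of the commuting factors of [iota x] then satisfy [wreath_commuting]. *)
Lemma commuting_factor_cycle (gT : finGroupType) (f : F -> discrete_group gT)
    (x : X) (m n : F) :
  C [set: gT]%G -> continuous_hom f -> M m -> N n ->
  (f m : gT) \in <[(f (iota x) : gT)]> \/ (f n : gT) \in <[(f (iota x) : gT)]>.
Proof.
move=> CG f_hom Mm Nn.
have [aT [a [CA abA lt_a]]] := C_large_order #|gT|.*2.
pose phi y : wreath aT gT :=
  if `[< y = x >] then wreath_delta a (f (iota y))
  else ([ffun=> 1], f (iota y)).
have phi2 y : (phi y).2 = f (iota y) by rewrite /phi; case: ifP.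
have CW := variety_wreath C_variety C_ext CA CG.
have [|t t_hom t_phi] := @free_pro_lift _ phi CW.
  (* Apart from [x], [phi] is nontrivial only where [f \o iota] is, hence at finitely many
     elements. *)
  rewrite -[X in finite_set X]setCK setCK.
  apply: (@sub_finite_set _ _ ([set x] `|` ~` [set y | f (iota y) = 1])).
    move=> y /= phi1; have [->|yx] := pselect (y = x); [by left|right=> fy].
    by apply: phi1; rewrite /phi; case: asboolP => // _; rewrite fy.
  rewrite finite_setU; split; first exact: finite_set1.
  exact: hom_iota_cofinite.
(* The projection of [t] agrees with [f] on the basis, so uniqueness in the universal property
   identifies them. *)
have t2 : (fun y => (t y).2 : discrete_group gT) = f.
  apply: free_pro_eq => //; last by move=> y; rewrite t_phi phi2.
  by apply: (@continuous_hom_discrete_comp (wreath aT gT) gT t snd) => // ? ?.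
have tf y : (t y).2 = f y by rewrite -[in RHS]t2.
have [u [v [Mu Nv iota_uv]]] := MN_full (iota x).
have tc p q : M p -> N q -> commute (t p : wreath aT gT) (t q).
  by move=> Mp Nq; rewrite /commute -2!t_hom.1 MN_commute.
have := @wreath_commuting aT gT a (f (iota x)) (t u) (t v) (t m) (t n) abA lt_a
  (tc _ _ Mu Nv) (tc _ _ Mu Nn) (tc _ _ Mm Nv) (tc _ _ Mm Nn).
rewrite -t_hom.1 -iota_uv t_phi /phi; case: asboolP => // _ /(_ erefl).
by rewrite !tf => /orP.
Qed.

(** If both sets had nontrivial elements [m1] and [n1], a single finite image could detect [m1],
    [n1] and the noncommuting pair [a], [b] at once; the cyclic constraints at [x] and at [y] are
    incompatible with this. *)
Lemma commuting_factor_trivial (x y : X) (sT : finGroupType) (a b : sT) :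
  x <> y -> C [set: sT]%G -> a * b <> b * a ->
  (forall m, M m -> m = 1) \/ (forall n, N n -> n = 1).
Proof.
move=> xy CS ab.
have [M1|/existsNP[m1 /not_implyP[Mm1 m1_neq1]]] :=
  pselect (forall m, M m -> m = 1); [by left|right].
apply: contrapT => /existsNP[n1 /not_implyP[Nn1 n1_neq1]].
have [proF _ _] := F_free.
have [gT1 [f1 [C1 f1_hom f1m]]] := pro_separated proF m1_neq1.
have [gT2 [f2 [C2 f2_hom f2n]]] := pro_separated proF n1_neq1.
pose phi3 z := if `[< z = x >] then a else if `[< z = y >] then b else 1.
have [|f3 f3_hom f3_phi] := @free_pro_lift sT phi3 CS.
  apply: (@sub_finite_set _ _ ([set x] `|` [set y])); last first.
    by rewrite finite_setU; split; exact: finite_set1.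
  move=> z /= phi1; apply: contrapT => /not_orP[zx zy]; apply: phi1.
  by rewrite /phi3; case: asboolP => // _; case: asboolP.
have f3x : f3 (iota x) = a by rewrite f3_phi /phi3; case: asboolP.
have f3y : f3 (iota y) = b.
  by rewrite f3_phi /phi3; case: asboolP => [/esym //|_]; case: asboolP.
pose gT0 : finGroupType := (gT1 * gT2 * sT)%type.
pose f0 z : discrete_group gT0 := (f1 z, f2 z, f3 z).
have f0_hom : continuous_hom f0.
  apply: (@continuous_hom_discrete_pair (gT1 * gT2)%type) => //.
  exact: continuous_hom_discrete_pair.
have C0 : C [set: gT0]%G by do 2?apply: variety_prod.
(* theta kills x and agrees with f0 on y, so that <f x> and <f y> meet trivially
   for f = (f0, theta). *)
pose theta z : gT0 := if `[< z = x >] then 1 else f0 (iota z).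
have [|h h_hom h_theta] := @free_pro_lift gT0 theta C0.
  apply: sub_cofinite_set (hom_iota_cofinite f0_hom) => z /= f0z.
  by rewrite /theta; case: asboolP.
pose gT : finGroupType := (gT0 * gT0)%type.
pose f z : discrete_group gT := (f0 z, h z).
have f_hom : continuous_hom f by apply: continuous_hom_discrete_pair.
have CG : C [set: gT]%G by apply: variety_prod.
have fx : f (iota x) = (f0 (iota x), 1).
  by rewrite /f h_theta /theta; case: asboolP.
have fy : f (iota y) = (f0 (iota y), f0 (iota y)).
  by rewrite /f h_theta /theta; case: asboolP => // /esym.
(* The alternative for single pairs becomes uniform: one [m] outside the cyclic group forces every
   [n] into it. *)
have cyc z : (forall m, M m -> (f m : gT) \in <[(f (iota z) : gT)]>) \/
             (forall n, N n -> (f n : gT) \in <[(f (iota z) : gT)]>).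
  have [MZ|/existsNP[m /not_implyP[Mm mZ]]] :=
    pselect (forall m, M m -> (f m : gT) \in <[(f (iota z) : gT)]>).
    by left.
  by right=> n Nn; have [] := commuting_factor_cycle z CG f_hom Mm Nn.
have expg_pair (u : gT) k : u ^+ k = (u.1 ^+ k, u.2 ^+ k).
  by elim: k => [//|k IHk]; rewrite !expgS IHk.
(* Membership in [<[f (iota x)]>] makes the second component 1; membership in [<[f (iota y)]>] makes
   the two components equal. *)
have TI z : (f z : gT) \in <[(f (iota x) : gT)]> ->
            (f z : gT) \in <[(f (iota y) : gT)]> -> f0 z = 1.
  rewrite fx fy => /cycleP[i]; rewrite expg_pair expg1n => -[_ hz].
  by case/cycleP => j; rewrite expg_pair => -[-> <-].
(* Two cyclic groups contain the images of [M] and [N], which also commute with each other, so the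
   whole image of [f] is abelian. *)
have abelian_case z w :
    (forall m, M m -> (f m : gT) \in <[(f (iota z) : gT)]>) ->
    (forall n, N n -> (f n : gT) \in <[(f (iota w) : gT)]>) -> False.
  move=> Mz Nw; apply: ab.
  have f_comm p q : f p * f q = f q * f p.
    have [p1 [p2 [Mp1 Np2 ->]]] := MN_full p.
    have [q1 [q2 [Mq1 Nq2 ->]]] := MN_full q.
    have cM : commute (f p1 : gT) (f q1).
      case/cycleP: (Mz _ Mp1) => i ->; case/cycleP: (Mz _ Mq1) => j ->.
      exact: commuteX2.
    have cN : commute (f p2 : gT) (f q2).
      case/cycleP: (Nw _ Np2) => i ->; case/cycleP: (Nw _ Nq2) => j ->.
      exact: commuteX2.
    have cMN m n : M m -> N n -> commute (f m : gT) (f n).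
      by move=> Mm Nn; rewrite /commute -!f_hom.1 MN_commute.
    rewrite !f_hom.1; apply: commuteM; apply: commute_sym; apply: commuteM => //;
      by [apply: commute_sym | apply: cMN | apply: commute_sym; apply: cMN].
  (* The selected coordinate is [f3], which takes the values [a] and [b] at [x] and [y]. *)
  have := congr1 (fun u : gT => u.1.2) (f_comm (iota x) (iota y)).
  by rewrite /= f3x f3y.
have [Mx|Nx] := cyc x; have [My|Ny] := cyc y.
- by apply: f1m; have := TI _ (Mx _ Mm1) (My _ Mm1) => -[].
- exact: abelian_case Mx Ny.
- exact: abelian_case My Nx.
- by apply: f2n; have := TI _ (Nx _ Nn1) (Ny _ Nn1) => -[].
Qed.

End FreeProC.

(** * Continuous homomorphisms and direct products *)

Lemma continuous_hom_comp (G H K : topologicalGroupType)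
  (f : G -> H) (g : H -> K) :
  continuous_hom f -> continuous_hom g -> continuous_hom (g \o f).
Proof.
move=> [fM cf] [gM cg]; split; first by move=> x y; rewrite /= fM gM.
by move=> x; apply: continuous_comp; [exact: cf | exact: cg].
Qed.

Lemma continuous_hom_pair (G H K : topologicalGroupType)
  (f : G -> H) (g : G -> K) :
  continuous_hom f -> continuous_hom g ->
  continuous_hom (fun x => (f x, g x) : (H * K)%type).
Proof.
move=> [fM cf] [gM cg]; split; first by move=> x y; rewrite fM gM.
by move=> x; apply: cvg_pair; [exact: cf | exact: cg].
Qed.

Lemma continuous_hom_fst (H K : topologicalGroupType) :
  continuous_hom (fst : (H * K)%type -> H).
Proof. by split=> // x; exact: cvg_fst. Qed.

Lemma continuous_hom_snd (H K : topologicalGroupType) :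
  continuous_hom (snd : (H * K)%type -> K).
Proof. by split=> // x; exact: cvg_snd. Qed.

Lemma continuous_hom_id (G : topologicalGroupType) : continuous_hom (@id G).
Proof. by split=> // x; exact: cvg_id. Qed.

Lemma continuous_hom_one (G H : topologicalGroupType) :
  continuous_hom (fun _ : G => 1 : H).
Proof. by split=> [x y|x]; [rewrite mulg1 | exact: cvg_cst]. Qed.

(** * Cancellation when one cross factor is trivial *)

Section CrossFactors.
Variables F A B : topologicalGroupType.
Variable phi : (F * A)%type -> (F * B)%type.
Hypothesis phi_hom : continuous_hom phi.

Lemma hom_pair_split u a : phi (u, a) = phi (u, 1) * phi (1, a).
Proof. by rewrite -phi_hom.1; congr (phi (_, _)); rewrite ?mulg1 ?mul1g. Qed.

Lemma continuous_hom_inr : continuous_hom (fun a => phi (1, a)).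
Proof.
apply: continuous_hom_comp phi_hom.
apply: continuous_hom_pair; first exact: continuous_hom_one.
exact: continuous_hom_id.
Qed.

(** The graph of [a |-> (phi (1, a)).1] is followed through [phi]. When [phi] maps the factor [F]
    into the kernel of the projection to [F], the first coordinate is unchanged along this graph,
    and this is the induced map on second coordinates. *)
Definition graph_map (a : A) : B := (phi ((phi (1, a)).1, a)).2.

Lemma continuous_hom_graph_map : continuous_hom graph_map.
Proof.
apply: continuous_hom_comp (continuous_hom_snd _ _).
apply: continuous_hom_comp phi_hom.
apply: continuous_hom_pair (continuous_hom_id _).
exact: continuous_hom_comp continuous_hom_inr (continuous_hom_fst _ _).
Qed.

Hypothesis phi_left_trivial : forall u, (phi (u, 1)).1 = 1.

Lemma fst_left_trivial u a : (phi (u, a)).1 = (phi (1, a)).1.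
Proof. by rewrite hom_pair_split /= phi_left_trivial mul1g. Qed.

Lemma graph_mapE a : phi ((phi (1, a)).1, a) = ((phi (1, a)).1, graph_map a).
Proof. by rewrite [LHS]surjective_pairing fst_left_trivial. Qed.

End CrossFactors.

(** Since [psi] sends [((phi (1, a)).1, graph_map phi a)] back to [((phi (1, a)).1, a)], and its
    first coordinate depends only on the second argument, the graph used for [psi] passes through
    that same point. *)
Lemma graph_mapK (F A B : topologicalGroupType)
  (phi : (F * A)%type -> (F * B)%type) (psi : (F * B)%type -> (F * A)%type) :
  continuous_hom phi -> continuous_hom psi -> cancel phi psi ->
  (forall u, (phi (u, 1)).1 = 1) -> (forall u, (psi (u, 1)).1 = 1) ->
  cancel (graph_map phi) (graph_map psi).
Proof.
move=> phi_hom psi_hom phiK phi1 psi1 a.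
have psiE : psi ((phi (1, a)).1, graph_map phi a) = ((phi (1, a)).1, a).
  by rewrite -graph_mapE // phiK.
rewrite {1}/graph_map -(fst_left_trivial psi_hom psi1 (phi (1, a)).1).
by rewrite psiE /= psiE.
Qed.

(** If both maps kill the same kind of cross factor, [graph_map] or restriction to the second
    factors gives the isomorphism; the two mixed cases force [F] to be trivial and reduce to
    restriction. *)
Lemma cancellation_dichotomy (F A B : topologicalGroupType)
  (phi : (F * A)%type -> (F * B)%type) (psi : (F * B)%type -> (F * A)%type) :
  continuous_hom phi -> continuous_hom psi ->
  cancel phi psi -> cancel psi phi ->
  (forall u, (phi (u, 1)).1 = 1) \/ (forall a, (phi (1, a)).1 = 1) ->
  (forall u, (psi (u, 1)).1 = 1) \/ (forall b, (psi (1, b)).1 = 1) ->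
  topologically_isomorphic A B.
Proof.
move=> phi_hom psi_hom phiK psiK.
(* Here [s (u, 1)] has first coordinate 1, so [t] returns it to a pair with first coordinate 1,
   which is [u]. *)
have mixed (G H : topologicalGroupType) (s : (F * G)%type -> (F * H)%type)
    (t : (F * H)%type -> (F * G)%type) : cancel s t ->
    (forall u, (s (u, 1)).1 = 1) -> (forall b, (t (1, b)).1 = 1) ->
    forall u : F, u = 1.
  move=> sK s1 t1 u; have := t1 (s (u, 1)).2.
  by rewrite -(s1 u) -surjective_pairing sK.
have direct :
    (forall a, (phi (1, a)).1 = 1) -> (forall b, (psi (1, b)).1 = 1) ->
    topologically_isomorphic A B.
  move=> phi1a psi1b.
  exists (fun a => (phi (1, a)).2), (fun b => (psi (1, b)).2); split.
  - exact: continuous_hom_comp (continuous_hom_inr phi_hom)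
             (continuous_hom_snd _ _).
  - exact: continuous_hom_comp (continuous_hom_inr psi_hom)
             (continuous_hom_snd _ _).
  - move=> a; have := phiK (1, a).
    by rewrite [phi _]surjective_pairing phi1a => ->.
  - move=> b; have := psiK (1, b).
    by rewrite [psi _]surjective_pairing psi1b => ->.
move=> [phi1u|phi1a] [psi1u|psi1b].
- exists (graph_map phi), (graph_map psi).
  split; by [exact: continuous_hom_graph_map | exact: graph_mapK].
- have F1 := mixed _ _ _ _ phiK phi1u psi1b.
  by apply: direct => // a; rewrite [LHS]F1.
- have F1 := mixed _ _ _ _ psiK psi1u phi1a.
  by apply: direct => // b; rewrite [LHS]F1.
- exact: direct.
Qed.


(** * Cancellation of a free pro-[C] group *)

Theorem theorem25 (C : finite_group_class)
  (C_variety : is_variety C)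
  (C_extension_closed : extension_closed C)
  (C_nonsolvable :
    ~ (forall (gT : finGroupType) (G : {group gT}), C gT G -> solvable G))
  (C_cyclic : forall p : nat, involved_primes C p -> C ('Z_p) (Zp_group p))
  (X : Type) (F : topologicalGroupType) (iota : X -> F)
  (F_free : is_free_pro C iota)
  (rank_gt1 : ~~ ([set: X] #<= `I_1))
  (A B : topologicalGroupType)
  (A_profinite : profinite A) (B_profinite : profinite B) :
  topologically_isomorphic (F * A)%type (F * B)%type ->
  topologically_isomorphic A B.
Proof.
have [gT [G [CG nsolG]]] : exists (gT : finGroupType) (G : {group gT}),
    C gT G /\ ~ solvable G.
  apply: contrapT => noG; apply: C_nonsolvable => gT G CG.
  by apply: contrapT => nsolG; apply: noG; exists gT, G.
have [a [b ab]] : exists a b : subg_of G, a * b <> b * a.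
  apply: contrapT => comm; apply: nsolG; apply: abelian_sol.
  apply/centsP => a Ga b Gb; apply: contrapT => ab; apply: comm.
  exists (subg G a), (subg G b) => /(congr1 sgval).
  by rewrite !morphM ?inE //= !subgK.
(* A nonsolvable group is nontrivial; a prime divisor of its order is involved in [C] and supplies
   the cyclic groups. *)
have C_large k : exists (aT : finGroupType) (a : aT),
    [/\ C aT [set: aT]%G, forall b c : aT, commute b c & (k < #[a])%N].
  have G_gt1 : (1 < #|G|)%N.
    rewrite ltnNge; apply/negP => /card_le1_trivg G1; apply: nsolG.
    by rewrite G1 solvable1.
  apply: (variety_large_order C_variety C_extension_closed _
           (pdiv_prime G_gt1)).
  apply: C_cyclic; split; first exact: pdiv_prime.
  by exists gT, G; split=> //; exact: pdiv_dvd.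
have [x [y xy]] : exists x y : X, x <> y.
  apply: contrapT => X1; move/negP: rank_gt1; apply.
  apply/pcard_leP/injfunPex; exists (fun=> 0%N) => // x y _ _ _.
  by apply: contrapT => xy; apply: X1; exists x, y.
case=> phi [psi [phi_hom psi_hom phiK psiK]].
(* The sets [M] and [N] are the projections to [F] of the images of the two factors: they commute
   because the factors do, and fill [F] because [s] is surjective. *)
have dichotomy (H K : topologicalGroupType) (s : (F * H)%type -> (F * K)%type)
    (t : (F * K)%type -> (F * H)%type) :
    continuous_hom s -> cancel t s ->
    (forall u, (s (u, 1)).1 = 1) \/ (forall h, (s (1, h)).1 = 1).
  move=> s_hom tK.
  have [|z|s1|s1] := @commuting_factor_trivial C C_variety C_extension_closed
    X F iota F_free C_large (range (fun u => (s (u, 1)).1))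
    (range (fun h => (s (1, h)).1)) _ _
    x y _ a b xy (variety_subg C_variety CG) ab.
  - move=> _ _ [u _ <-] [h _ <-].
    rewrite -[_ * _](congr1 fst (hom_pair_split s_hom u h)).
    rewrite [_ * (s (u, 1)).1](_ : _ = (s (1, h) * s (u, 1)).1) // -s_hom.1.
    by congr (s (_, _)).1; rewrite ?mulg1 ?mul1g.
  - exists (s ((t (z, 1)).1, 1)).1, (s (1, (t (z, 1)).2)).1.
    split; [by exists (t (z, 1)).1 | by exists (t (z, 1)).2 |].
    rewrite -[RHS](congr1 fst (hom_pair_split s_hom _ _)).
    by rewrite -surjective_pairing tK.
  - by left=> u; apply: s1; exists u.
  - by right=> h; apply: s1; exists h.
apply: (cancellation_dichotomy phi_hom psi_hom phiK psiK).
  exact: dichotomy phi_hom psiK.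
exact: dichotomy psi_hom phiK.
Qed.
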